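(* Let $(q,u,B,S)$ be a solution to the system (MHD$_\varepsilon$). Then $$[\rho^{-1}B\cdot\nabla,\,D_t]=0,$$ i.e. $(\rho^{-1}B\cdot\nabla)(D_tf)=D_t(\rho^{-1}B\cdot\nabla f)$ for every sufficiently regular function $f$ on $[0,T]\times\Omega$.
   Context: Domain: $\Omega=\mathbb{R}^3_+=\{x\in\mathbb{R}^3:x_3>0\}$, $\Sigma=\{x_3=0\}$. $\varepsilon>0$ is the Mach number; $u$ is the velocity, $B$ the magnetic field, $S$ the entropy, $p=1+\varepsilon q$ the fluid pressure, $D_t:=\partial_t+u\cdot\nabla$. Equation of state: the density $\rho=\rho(p,S)$ is a given smooth function with $\rho\ge\bar\rho_0>0$ and $\partial\rho/\partial p>0$; $a:=\frac1\rho\frac{\partial\rho}{\partial p}>0$. Since $p=1+\varepsilon q$, one regards $\rho$ and $a$ as functions of $(\varepsilon q,S)$; here $\rho$ denotes $\rho(\varepsilon q(t,x),S(t,x))$, and similarly for $a$. System (MHD$_\varepsilon$) on $[0,T]\times\Omega$: $aD_tq+\varepsilon^{-1}\nabla\cdot u=0$ (equivalently, given $D_tS=0$, $D_t\rho+\rho\nabla\cdot u=0$); $\rho D_tu+\varepsilon^{-1}\nabla q+\frac12\nabla|B|^2-B\cdot\nabla B=0$; $D_tB=B\cdot\nabla u-B(\nabla\cdot u)$; $\nabla\cdot B=0$; $D_tS=0$; with $u_3=B_3=0$ on $[0,T]\times\Sigma$ and initial data $(q,u,B,S)|_{t=0}=(q_0,u_0,B_0,S_0)$. *)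

(* Defs.v *)
From HB Require Import structures.
From mathcomp Require Import all_boot all_order all_algebra.
From mathcomp Require Import all_classical all_reals all_analysis.

Set Implicit Arguments.
Unset Strict Implicit.
Unset Printing Implicit Defensive.

Import Order.TTheory GRing.Theory Num.Theory.
Import numFieldNormedType.Exports.

Local Open Scope classical_set_scope.
Local Open Scope ring_scope.

Section Domain.
Context {R : realType}.

(* The coordinates x_1, x_2, x_3 are x 0 0, x 0 1, x 0 ord_max. *)
Definition Omega : set 'rV[R]_3 := [set x | 0 < x 0 ord_max].
Definition Omega_closure : set 'rV[R]_3 := [set x | 0 <= x 0 ord_max].
Definition Sigma : set 'rV[R]_3 := [set x | x 0 ord_max = 0].
Definition slab (T : R) : set R := [set t | 0 <= t <= T].

End Domain.

Section Calculus.
Context {R : realType} {V : normedModType R}.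
Implicit Types (f : R -> 'rV[R]_3 -> V) (g : 'rV[R]_3 -> V).

Definition partial (i : 'I_3) g (x : 'rV[R]_3) : V := 'D_(delta_mx 0 i) g x.

(* The difference quotient is restricted to times in [0, T], so that the time
   derivative is the one-sided one at t = 0 and t = T. *)
Definition time_quotient f (t : R) (x : 'rV[R]_3) (s : R) : V :=
  (s - t)^-1 *: (f s x - f t x).

Definition time_derivable (T : R) f t x : Prop :=
  cvg (time_quotient f t x @ within (slab T) t^').

Definition time_derive (T : R) f t x : V :=
  lim (time_quotient f t x @ within (slab T) t^').

Definition convective (w : 'rV[R]_3) g x : V :=
  \sum_(i < 3) w 0 i *: partial i g x.

Definition material (T : R) (u : R -> 'rV[R]_3 -> 'rV[R]_3) f t x : V :=
  time_derive T f t x + convective (u t x) (f t) x.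

Definition continuous_on (T : R) (D : set 'rV[R]_3) f : Prop :=
  {within slab T `*` D, continuous (fun z : R * 'rV[R]_3 => f z.1 z.2)}.

(* f is of class C^k on [0, T] x Omega. *)
Fixpoint class_C (T : R) (k : nat) f : Prop :=
  continuous_on T Omega f /\
  if k is k'.+1 then
    [/\ forall t x, slab T t -> Omega x -> time_derivable T f t x,
        forall i t x, slab T t -> Omega x -> derivable (f t) x (delta_mx 0 i),
        class_C T k' (time_derive T f) &
        forall i, class_C T k' (fun t => partial i (f t))]
  else True.

End Calculus.

Section VectorCalculus.
Context {R : realType}.

Definition gradient (g : 'rV[R]_3 -> R) (x : 'rV[R]_3) : 'rV[R]_3 :=
  \row_i partial i g x.

Definition divergence (w : 'rV[R]_3 -> 'rV[R]_3) (x : 'rV[R]_3) : R :=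
  \sum_(i < 3) partial i (fun y => w y 0 i) x.

(* Squared Euclidean norm; `|v| on 'rV[R]_3 is the sup norm. *)
Definition sqnorm (v : 'rV[R]_3) : R := \sum_(i < 3) v 0 i ^+ 2.

End VectorCalculus.

Section EquationOfState.
Context {R : realType}.

Fixpoint class_C_plane (k : nat) (F : R * R -> R) : Prop :=
  if k is k'.+1 then
    (forall z, differentiable F z) /\
    forall v, class_C_plane k' (fun z => 'D_v F z)
  else continuous F.

Record equation_of_state (rho : R -> R -> R) (rho0 : R) : Prop := {
  eos_smooth : forall k, class_C_plane k (fun z => rho z.1 z.2);
  eos_rho0_gt0 : 0 < rho0;
  eos_lower_bound : forall p s, rho0 <= rho p s;
  eos_increasing : forall p s, 0 < derive1 (fun p' => rho p' s) p }.

(* a = rho^-1 * (d rho / d p), as a function of (p, S). *)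
Definition compressibility (rho : R -> R -> R) (p s : R) : R :=
  (rho p s)^-1 * derive1 (fun p' => rho p' s) p.

(* A function of state h(p, S) along the flow, where p = 1 + eps q. *)
Definition along (eps : R) (h : R -> R -> R) (q S : R -> 'rV[R]_3 -> R)
  (t : R) (x : 'rV[R]_3) : R := h (1 + eps * q t x) (S t x).

End EquationOfState.

Section MHD.
Context {R : realType}.

Record MHD_solution (eps T : R) (rho : R -> R -> R)
    (q0 : 'rV[R]_3 -> R) (u0 B0 : 'rV[R]_3 -> 'rV[R]_3) (S0 : 'rV[R]_3 -> R)
    (q : R -> 'rV[R]_3 -> R) (u B : R -> 'rV[R]_3 -> 'rV[R]_3)
    (S : R -> 'rV[R]_3 -> R) : Prop := {
  mhd_C1 : [/\ class_C T 1 q, class_C T 1 u, class_C T 1 B & class_C T 1 S];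
  (* gives a meaning to the boundary condition on Sigma *)
  mhd_continuous : [/\ continuous_on T Omega_closure q,
    continuous_on T Omega_closure u, continuous_on T Omega_closure B &
    continuous_on T Omega_closure S];
  mhd_pressure : forall t x, slab T t -> Omega x ->
    along eps (compressibility rho) q S t x * material T u q t x
    + eps^-1 * divergence (u t) x = 0;
  mhd_momentum : forall t x, slab T t -> Omega x ->
    along eps rho q S t x *: material T u u t x
    + eps^-1 *: gradient (q t) x
    + 2^-1 *: gradient (fun y => sqnorm (B t y)) x
    - convective (B t x) (B t) x = 0;
  mhd_induction : forall t x, slab T t -> Omega x ->
    material T u B t x
    = convective (B t x) (u t) x - divergence (u t) x *: B t x;
  mhd_solenoidal : forall t x, slab T t -> Omega x -> divergence (B t) x = 0;
  mhd_entropy : forall t x, slab T t -> Omega x -> material T u S t x = 0;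
  mhd_boundary : forall t x, slab T t -> Sigma x ->
    u t x 0 ord_max = 0 /\ B t x 0 ord_max = 0;
  mhd_initial : forall x, Omega x ->
    [/\ q 0 x = q0 x, u 0 x = u0 x, B 0 x = B0 x & S 0 x = S0 x] }.

Definition magnetic_derivative (eps : R) (rho : R -> R -> R)
    (q S : R -> 'rV[R]_3 -> R) (B : R -> 'rV[R]_3 -> 'rV[R]_3)
    (f : R -> 'rV[R]_3 -> R) (t : R) (x : 'rV[R]_3) : R :=
  convective ((along eps rho q S t x)^-1 *: B t x) (f t) x.

End MHD.

(* Main.v *)
Require Import Defs.
From mathcomp Require Import all_boot all_order all_algebra.
From mathcomp Require Import all_classical all_reals all_analysis.
From mathcomp Require Import ring.

Import Order.TTheory GRing.Theory Num.Theory.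
Import numFieldNormedType.Exports.

Local Open Scope classical_set_scope.
Local Open Scope ring_scope.

(** Write [D = d_t + u . grad] and [beta = rho^-1 B].  On spacetime both
    operators are vector fields: [D] has components [(1, u)] and
    [beta . grad] has components [(0, beta)].  The commutator of two vector
    fields [X] and [Y] applied to a C^2 function is again first order,
    [[X, Y] f = \sum_l (X Y_l - Y X_l) d_l f], because the second-order terms
    cancel by symmetry of mixed derivatives ([field_commutator]).  The time
    components are constant, so the commutator vanishes as soon as
    [D beta_i = beta . grad u_i] for each space component, that is, as soon as
    the field lines of [beta] are carried by the flow ([material_flux]).

    This frozen-flux identity is where the equations enter.  Since [D S = 0],
    the chain rule gives [D rho = eps (d rho / d p) D q], and the pressure
    equation turns this into [D rho = - rho div u] ([material_density]).  In
    [D (rho^-1 B) = - rho^-2 (D rho) B + rho^-1 D B] the first term is then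
    [rho^-1 (div u) B], which cancels the term [- rho^-1 (div u) B] coming from
    the induction equation, and [rho^-1 B . grad u] remains.

    The analytic difficulty is that time derivatives are one-sided at [t = 0]
    and [t = T].  All derivatives are treated as directional derivatives in
    spacetime whose increments stay in a set ([is_derive_within]), so that each
    rule of calculus is proved once for time and space.  Symmetry of mixed
    derivatives is obtained at interior times by the two-dimensional mean value
    theorem ([mixed_derivatives_eq]) and extended to the end times by
    continuity of the second derivatives ([axis_derive_comm]). *)

(** * Directional derivatives with constrained increments *)

Section DirectionalDerivativeWithin.
Set Implicit Arguments.
Unset Strict Implicit.
Context {R : realType} {V : normedModType R}.
Implicit Types (A : set V) (z v : V).

Definition steps_within A z v : set_system R :=
  within [set h | A (h *: v + z)] 0^'.

(** Keeping [h *: v + z] in [A] gives one-sided derivatives at boundary points.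
    The filter [steps_within A z v] may be improper, so that the limit [l] is
    specified by convergence and not through [lim]. *)
Definition is_derive_within {W : normedModType R} A z v (F : V -> W) (l : W) :=
  (fun h => h^-1 *: (F (h *: v + z) - F z)) @ steps_within A z v --> l.

Instance steps_within_filter A z v : Filter (steps_within A z v).
Proof. exact: within_filter. Qed.

Lemma steps_within_neq0 A z v : \forall h \near steps_within A z v, h != 0.
Proof.
by apply: cvg_within; near=> h; near: h; exact: nbhs_dnbhs_neq.
Unshelve. all: by end_near. Qed.

Lemma steps_within_cvg0 A z v : id @ steps_within A z v --> (0 : R).
Proof.
apply: cvg_trans; last exact: nbhs_dnbhs.
exact: cvg_within.
Qed.

Lemma is_derive_within_continuous {W : normedModType R} A z v (F : V -> W) l :
  is_derive_within A z v F l ->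
  F (h *: v + z) @[h --> steps_within A z v] --> F z.
Proof.
move=> dF.
have : (F z + h *: (h^-1 *: (F (h *: v + z) - F z)))
    @[h --> steps_within A z v] --> F z + 0 *: l.
  by apply: cvgD; [exact: cvg_cst|apply: cvgZ => //; exact: steps_within_cvg0].
rewrite scale0r addr0; apply: cvg_trans; apply: near_eq_cvg.
apply: filterS (steps_within_neq0 A z v) => h h0.
by rewrite scalerA divff// scale1r addrC subrK.
Qed.

Lemma is_derive_within_cst {W : normedModType R} A z v (c : W) :
  is_derive_within A z v (fun=> c) 0.
Proof.
rewrite /is_derive_within; under eq_fun do rewrite subrr scaler0.
exact: cvg_cst.
Qed.

Lemma is_derive_withinM A z v (F G : V -> R) l m :
  is_derive_within A z v F l -> is_derive_within A z v G m ->
  is_derive_within A z v (fun y => F y * G y) (l * G z + F z * m).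
Proof.
move=> dF dG; have cG := is_derive_within_continuous dG.
rewrite /is_derive_within.
rewrite (_ : (fun h => _) = (fun h => (h^-1 *: (F (h *: v + z) - F z)) *
   G (h *: v + z) + F z * (h^-1 *: (G (h *: v + z) - G z)))); last first.
  by apply/funext => h; rewrite /GRing.scale/=; ring.
by apply: cvgD; apply: cvgM => //; exact: cvg_cst.
Qed.

Lemma is_derive_within_sum {W : normedModType R} A z v (I : finType)
    (F : I -> V -> W) (l : I -> W) :
  (forall i, is_derive_within A z v (F i) (l i)) ->
  is_derive_within A z v (fun y => \sum_i F i y) (\sum_i l i).
Proof.
move=> dF; rewrite (_ : (fun y => _) = \sum_i F i); last first.
  by apply/funext => y; rewrite fct_sumE.
apply: (big_ind2 (is_derive_within A z v)) => //.
  exact: is_derive_within_cst.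
move=> G l1 H l2 dG dH; rewrite /is_derive_within.
rewrite (_ : (fun h => _) = (fun h => h^-1 *: (G (h *: v + z) - G z) +
    h^-1 *: (H (h *: v + z) - H z))); first exact: cvgD.
by apply/funext => h; rewrite -scalerDr addrACA -opprD.
Qed.

Lemma is_derive_within_pair {W W' : normedModType R} A z v
    (F : V -> W) (G : V -> W') l m :
  is_derive_within A z v F l -> is_derive_within A z v G m ->
  is_derive_within A z v (fun y => (F y, G y)) (l, m).
Proof. by move=> dF dG; exact: (cvg_pair dF dG). Qed.

(** The curve [h |-> F (h *: v + z)] is defined only on part of a neighbourhood
    of [0], so that the chain rule for differentiable functions does not apply.
    The increment of [F] is [O(h)] because its difference quotient is bounded;
    hence the remainder of [phi], little-o of this increment, is [o(h)]. *)
Lemma is_derive_within_comp {W W' : normedModType R} A z v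
    (F : V -> W) l (phi : W -> W') :
  is_derive_within A z v F l -> differentiable phi (F z) ->
  is_derive_within A z v (phi \o F) ('d phi (F z) l).
Proof.
move=> dF dphi.
have cF := is_derive_within_continuous dF.
have /diff_locallyxP [cd loc] := dphi.
move: loc; set e := 'o_ _ _ => loc.
have {}loc h : phi (F (h *: v + z)) - phi (F z) =
    'd phi (F z) (F (h *: v + z) - F z) + e (F (h *: v + z) - F z).
  have := loc (F (h *: v + z) - F z); rewrite subrK => ->.
  by rewrite addrAC [X in X + _]addrAC subrr add0r.
rewrite /is_derive_within.
under eq_fun do rewrite /= loc scalerDr -linearZ/=.
rewrite -['d phi (F z) l]addr0; apply: cvgD.
  exact: (cvg_comp _ _ dF (cd l)).
apply/cvgr0Pnorm_le => d d0.
have k0 : (F (h *: v + z) - F z) @[h --> steps_within A z v] --> (0 : W).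
  by rewrite -(subrr (F z)); apply: cvgB => //; exact: cvg_cst.
have M0 : 0 < `|l| + 1 by rewrite ltr_wpDl.
have eo : \forall k \near (0 : W), `|e k| <= d / (`|l| + 1) * `|k|.
  exact: (littleoP _ (divr_gt0 d0 M0)).
have {}eo : \forall h \near steps_within A z v,
    `|e (F (h *: v + z) - F z)| <= d / (`|l| + 1) * `|F (h *: v + z) - F z|.
  exact: k0 eo.
have slope_bd : \forall h \near steps_within A z v,
    `|h^-1 *: (F (h *: v + z) - F z)| <= `|l| + 1.
  have := @cvgr_norm_lt _ _ _ _ _ _ _ dF (`|l| + 1).
  rewrite ltrDl => /(_ _ ltr01); apply: filterS => h; exact: ltW.
near=> h.
have h0 : h != 0 by near: h; exact: steps_within_neq0.
rewrite normrZ (@le_trans _ _ (`|h^-1| *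
  (d / (`|l| + 1) * `|F (h *: v + z) - F z|)))//.
  by rewrite ler_wpM2l//; near: h.
rewrite mulrCA -normrZ -ler_pdivlMl ?divr_gt0// invf_div mulfVK ?gt_eqF//.
by near: h.
Unshelve. all: by end_near. Qed.

End DirectionalDerivativeWithin.

(** * Symmetry of mixed derivatives *)

Section MixedDerivatives.
Set Implicit Arguments.
Unset Strict Implicit.
Context {R : realType}.

(** Apply the mean value theorem first to [s |-> g s d - g s c], whose
    derivative is [g1 s d - g1 s c], and then to [g1 s] on [[c, d]]. *)
Lemma mixed_difference_mean_value (g g1 g12 : R -> R -> R) (a b c d : R) :
  a < b -> c < d ->
  (forall s r, s \in `[a, b] -> r \in `[c, d] ->
    is_derive s 1 (g ^~ r) (g1 s r)) ->
  (forall s r, s \in `[a, b] -> r \in `[c, d] ->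
    is_derive r 1 (g1 s) (g12 s r)) ->
  exists s r, [/\ s \in `[a, b], r \in `[c, d] &
    g b d - g b c - (g a d - g a c) = g12 s r * (b - a) * (d - c)].
Proof.
move=> ab cd dg dg1.
have cin : c \in `[c, d] by rewrite bound_itvE ltW.
have din : d \in `[c, d] by rewrite bound_itvE ltW.
have dgcd s : s \in `[a, b] ->
    is_derive s 1 (fun s => g s d - g s c) (g1 s d - g1 s c).
  by move=> sab; apply: is_deriveB; exact: dg.
have [|s sab ->] := @MVT R (fun s => g s d - g s c) (fun s => g1 s d - g1 s c)
    _ _ ab (fun s sab => dgcd s (subset_itv_oo_cc sab)).
  by apply: derivable_within_continuous => s /dgcd [].
have {}sab := subset_itv_oo_cc sab.
have [|r rcd ->] := MVT cd
    (fun r rcd => dg1 s r sab (subset_itv_oo_cc rcd)).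
  by apply: derivable_within_continuous => r /(dg1 _ _ sab) [].
exists s, r; split=> //; first exact: subset_itv_oo_cc.
by rewrite mulrAC.
Qed.

Lemma is_derive_along_line {V W : normedModType R} (F : V -> W) (y v : V)
    (s : R) l :
  is_derive (s *: v + y) v F l -> is_derive s 1 (fun r => F (r *: v + y)) l.
Proof.
move=> [dF <-]; have slopeE : (fun h : R => h^-1 *:
      (((fun r => F (r *: v + y)) \o shift s) (h *: 1) - F (s *: v + y))) =
    (fun h => h^-1 *: ((F \o shift (s *: v + y)) (h *: v) - F (s *: v + y))).
  by apply/funext => h /=; rewrite [h *: 1]mulr1 scalerDl addrA.
by split; rewrite /derivable /derive slopeE.
Qed.

(** The mixed second difference of [F] over a small parallelogram at [z] does
    not depend on the order of the two directions.  Evaluating it by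
    [mixed_difference_mean_value] in both orders yields a value of [P] and a
    value of [Q], at two points near [z], that agree; were [P z] and [Q z]
    different, continuity would separate these values. *)
Lemma mixed_derivatives_eq {V : normedModType R} (F G H P Q : V -> R) (z v w : V) :
  (\forall y \near z, is_derive y v F (G y)) ->
  (\forall y \near z, is_derive y w F (H y)) ->
  (\forall y \near z, is_derive y w G (P y)) ->
  (\forall y \near z, is_derive y v H (Q y)) ->
  {for z, continuous P} -> {for z, continuous Q} -> P z = Q z.
Proof.
move=> dvF dwF dwG dvH cP cQ; apply/eqP/negPn/negP => PQ.
pose d := `|P z - Q z| / 2.
have d0 : 0 < d by rewrite divr_gt0// normr_gt0 subr_eq0.
have : \forall y \near z, [/\ is_derive y v F (G y), is_derive y w F (H y),
    is_derive y w G (P y), is_derive y v H (Q y) &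
    `|P z - P y| < d /\ `|Q z - Q y| < d].
  move/cvgrPdist_lt: cP => /(_ _ d0) nP; move/cvgrPdist_lt: cQ => /(_ _ d0) nQ.
  by near=> y; split; [..|split]; near: y.
move=> /nbhs_ballP[e /= e0 ze].
(* This size keeps the parallelogram of sides [r v] and [r w] in the ball;
   the added 1 avoids a division by zero. *)
pose r := e / (`|v| + `|w| + 1).
have M0 : 0 < `|v| + `|w| + 1 by rewrite ltr_wpDl// addr_ge0.
have r0 : 0 < r by rewrite divr_gt0.
have zr s t : s \in `[0, r] -> t \in `[0, r] -> ball z e (s *: v + (t *: w + z)).
  rewrite !in_itv/= => /andP[s0 sr] /andP[t0 tr].
  rewrite -ball_normE/= addrA opprD addrCA subrr addr0 normrN.
  rewrite (le_lt_trans (ler_normD _ _))// !normrZ !ger0_norm//.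
  rewrite (@le_lt_trans _ _ (r * (`|v| + `|w|)))//.
    by rewrite mulrDr lerD// ler_wpM2r.
  by rewrite /r mulrAC ltr_pdivrMr// ltr_pM2l// ltrDl.
have [|||s [t [sr tr]]] := @mixed_difference_mean_value
  (fun s t => F (s *: v + (t *: w + z))) (fun s t => G (s *: v + (t *: w + z)))
  (fun s t => P (s *: v + (t *: w + z))) 0 r 0 r r0.
- exact: r0.
- by move=> s t sr tr; apply: is_derive_along_line; have [] := ze _ (zr _ _ sr tr).
- move=> s t sr tr; rewrite (_ : (fun t => _) = (fun t => G (t *: w + (s *: v + z)))).
    apply: is_derive_along_line; rewrite addrCA.
    by have [] := ze _ (zr _ _ sr tr).
  by apply/funext => t'; rewrite addrCA.
(* The same second difference, with the two directions exchanged. *)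
have [|||t' [s' [t'r s'r]]] := @mixed_difference_mean_value
  (fun t s => F (s *: v + (t *: w + z))) (fun t s => H (s *: v + (t *: w + z)))
  (fun t s => Q (s *: v + (t *: w + z))) 0 r 0 r r0.
- exact: r0.
- move=> t1 s1 t1r s1r; rewrite (_ : (fun t => _) =
    (fun t => F (t *: w + (s1 *: v + z)))).
    apply: is_derive_along_line; rewrite addrCA.
    by have [] := ze _ (zr _ _ s1r t1r).
  by apply/funext => t2; rewrite addrCA.
- move=> t1 s1 t1r s1r; apply: is_derive_along_line.
  by have [] := ze _ (zr _ _ s1r t1r).
have rn0 : r - 0 != 0 by rewrite subr0 gt_eqF.
have [_ _ _ _ [_ dQ]] := ze _ (zr _ _ s'r t'r).
have [_ _ _ _ [dP _]] := ze _ (zr _ _ sr tr).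
move=> EQ EP.
have PQ' : P (s *: v + (t *: w + z)) = Q (s' *: v + (t' *: w + z)).
  by apply: (mulIf rn0); apply: (mulIf rn0); rewrite -EP -EQ; ring.
have := ler_distD (P (s *: v + (t *: w + z))) (P z) (Q z).
rewrite leNgt [in X in _ + X]PQ' [in X in _ + X]distrC => /negP; apply.
by rewrite [ltRHS]splitr ltrD.
Unshelve. all: by end_near. Qed.

End MixedDerivatives.

(** * The time interval *)

Section Slab.
Set Implicit Arguments.
Unset Strict Implicit.
Context {R : realType}.

Lemma within_dnbhs_shift (A : set R) (t : R) :
  within A t^' = (h + t) @[h --> within [set h | A (h + t)] 0^'].
Proof.
have dnbhs_shift P : t^' P = (\forall h \near 0^', P (h + t)).
  have := near_shift 0 t (fun s => s != t -> P s); rewrite subr0 => tE.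
  transitivity (\forall s \near t, s != t -> P s); first by [].
  rewrite tE; transitivity (\forall h \near 0, h != 0 -> P (h + t)) => //.
  by congr (nbhs _ _); apply/funext => h /=; rewrite -subr_eq0 addrK.
by apply/funext => P; exact: (dnbhs_shift (fun s => A s -> P s)).
Qed.

(** Interior times accumulate at each point of [[0, T]], end points included:
    this makes the one-sided derivatives unique, and lets identities pass
    from interior times to [0] and [T]. *)
Lemma interior_times_proper (T t : R) : 0 < T -> slab T t ->
  ProperFilter (within [set s | 0 < s < T] t^').
Proof.
move=> T0 /andP[t0 tT]; apply: Build_ProperFilter_ex => P.
rewrite /within/= => /nbhs_ballP[e /= e0 eP].
have [tltT|] := ltP t T.
  have m0 : 0 < Num.min e (T - t) by rewrite lt_min e0 subr_gt0.
  exists (t + Num.min e (T - t) / 2); apply: eP.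
  - rewrite -ball_normE/= opprD addNKr normrN gtr0_norm ?divr_gt0//.
    rewrite (@lt_le_trans _ _ (Num.min e (T - t)))// ?ge_min ?lexx//.
    by rewrite gtr_pMr// invf_lt1// ltr1n.
  - by rewrite -subr_eq0 addrAC subrr add0r gt_eqF// divr_gt0.
  - apply/andP; split; first by rewrite ltr_wpDl// divr_gt0.
    rewrite -ltrBrDl (@lt_le_trans _ _ (Num.min e (T - t)))//;
      last by rewrite ge_min lexx orbT.
    by rewrite gtr_pMr// invf_lt1// ltr1n.
move=> Tt; have m0 : 0 < Num.min e T by rewrite lt_min e0.
have mh : Num.min e T / 2 < Num.min e T by rewrite gtr_pMr// invf_lt1// ltr1n.
have tE : t = T by apply/le_anti/andP.
rewrite tE in eP *.
exists (T - Num.min e T / 2); apply: eP.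
- rewrite -ball_normE/= opprB addrC subrK gtr0_norm ?divr_gt0//.
  by rewrite (lt_le_trans mh)// ge_min lexx.
- by rewrite -subr_eq0 addrAC subrr add0r oppr_eq0 gt_eqF// divr_gt0.
- rewrite /= subr_gt0 (lt_le_trans mh) ?ge_min ?lexx ?orbT//=.
  by rewrite ltrBlDr ltrDl divr_gt0.
Qed.

Lemma interior_times_slab (T t : R) :
  within [set s | 0 < s < T] t^' --> within (slab T) t^'.
Proof.
move=> P; apply: (@filterS _ t^') => s sP /andP[s0 sT].
by apply: sP; rewrite /slab/= !ltW.
Qed.

Lemma slab_dnbhs_proper (T t : R) : 0 < T -> slab T t ->
  ProperFilter (within (slab T) t^').
Proof.
move=> T0 tT; have := interior_times_proper T0 tT => PF.
split; first by move/(@interior_times_slab T t); exact: filter_not_empty.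
exact: within_filter.
Qed.

End Slab.

(** * Time and space derivatives as spacetime derivatives *)

Section SpacetimeDerivatives.
Set Implicit Arguments.
Unset Strict Implicit.
Context {R : realType}.
Implicit Types (T t : R) (x : 'rV[R]_3) (k : option 'I_3).

(** [None] is the time direction and [Some i] the space direction [i]. *)
Definition axis k : R * 'rV[R]_3 :=
  if k is Some i then (0, delta_mx 0 i) else (1, 0).

Definition uncurried {V : Type} (f : R -> 'rV[R]_3 -> V) (z : R * 'rV[R]_3) :=
  f z.1 z.2.

Definition axis_derive {V : normedModType R} T k (f : R -> 'rV[R]_3 -> V) t x :=
  if k is Some i then partial i (f t) x else time_derive T f t x.

(** Only the time is constrained: at a fixed time of the slab every increment
    in space is allowed, which gives the two-sided partial derivatives. *)
Definition is_axis_derive {V : normedModType R} T k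
    (f : R -> 'rV[R]_3 -> V) t x (l : V) :=
  is_derive_within (slab T `*` setT) (t, x) (axis k) (uncurried f) l.

Context {V : normedModType R}.
Implicit Types (f : R -> 'rV[R]_3 -> V) (l : V).

Lemma is_axis_derive_timeP T f t x l :
  time_quotient f t x @ within (slab T) t^' --> l <->
  is_axis_derive T None f t x l.
Proof.
rewrite within_dnbhs_shift /is_axis_derive /is_derive_within /steps_within.
rewrite (_ : [set h : R | _] = [set h | slab T (h + t)]); last first.
  by apply/seteqP; split=> h /=; [case; rewrite [h *: 1]mulr1|
    rewrite [h *: 1]mulr1].
rewrite -fmap_comp.
rewrite (_ : _ \o _ = (fun h => h^-1 *:
   (uncurried f (h *: axis None + (t, x)) - uncurried f (t, x))))//.
apply/funext => h /=.
by rewrite /time_quotient /uncurried/= addrK scaler0 add0r [h *: 1]mulr1.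
Qed.

Lemma is_axis_derive_spaceP T i f t x l : slab T t ->
  is_derive x (delta_mx 0 i) (f t) l <-> is_axis_derive T (Some i) f t x l.
Proof.
move=> tT; rewrite /is_axis_derive /is_derive_within /steps_within.
rewrite (_ : [set h : R | _] = setT) ?withinET; last first.
  by apply/seteqP; split=> h //= _; rewrite scaler0 add0r.
rewrite (_ : (fun h : R => _) = (fun h => h^-1 *:
   ((f t \o shift x) (h *: delta_mx 0 i) - f t x))); last first.
  by apply/funext => h /=; rewrite /uncurried/= scaler0 add0r.
split; first by case=> df <-.
by move=> fl; split; [apply/cvg_ex; exists l|exact: cvg_lim fl].
Qed.

Lemma is_axis_deriveE T k f t x l : 0 < T -> slab T t ->
  is_axis_derive T k f t x l -> axis_derive T k f t x = l.
Proof.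
move=> T0 tT; case: k => [i /is_axis_derive_spaceP|].
  by move=> /(_ tT) [].
move=> /is_axis_derive_timeP; have := slab_dnbhs_proper T0 tT => ? fl.
exact: cvg_lim fl.
Qed.

Lemma is_axis_derive_val T k f t x l : 0 < T -> slab T t ->
  is_axis_derive T k f t x l ->
  is_axis_derive T k f t x (axis_derive T k f t x).
Proof. by move=> T0 tT fl; rewrite (is_axis_deriveE T0 tT fl). Qed.

Lemma class_C_is_axis_derive T n k f t x : class_C T n.+1 f ->
  slab T t -> Omega x -> is_axis_derive T k f t x (axis_derive T k f t x).
Proof.
move=> [_ [dtf dxf _ _]] tT xO; case: k => [i|].
  by apply/is_axis_derive_spaceP => //; apply/derivableP; exact: dxf.
exact/is_axis_derive_timeP/dtf.
Qed.

Lemma class_C_axis_derive T n k f :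
  class_C T n.+1 f -> class_C T n (axis_derive T k f).
Proof. by move=> [_ [_ _ ctf cxf]]; case: k. Qed.

Lemma class_C_continuous T n f : class_C T n f -> continuous_on T Omega f.
Proof. by case: n => [|n] []. Qed.

(** Near [0], increments of an interior time stay in [[0, T]]. *)
Lemma is_axis_derive_interior T k f t x l : 0 < t < T ->
  is_axis_derive T k f t x l -> is_derive (t, x) (axis k) (uncurried f) l.
Proof.
move=> /andP[t0 tT].
rewrite /is_axis_derive /is_derive_within /steps_within => fl.
have {}fl : (fun h => h^-1 *:
    (uncurried f (h *: axis k + (t, x)) - uncurried f (t, x))) @ 0^' --> l.
  move=> A /fl; rewrite /fmap/= /within/=.
  have nin : \forall h \near 0^', (slab T `*` setT) (h *: axis k + (t, x)).
    have : h * (axis k).1 + t @[h --> 0^'] --> 0 * (axis k).1 + t.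
      apply: cvgD; last exact: cvg_cst.
      by apply: cvgM; [exact: nbhs_dnbhs|exact: cvg_cst].
    rewrite mul0r add0r => ct.
    have tin : \forall s \near t, s \in `]0, T[.
      by apply: near_in_itvoo; rewrite in_itv/= t0 tT.
    have := ct _ tin; apply: (@filterS _ 0^') => h /=.
    by rewrite in_itv/= => /andP[h0 hT]; split=> //=; rewrite /slab/= !ltW.
  by move=> H; apply: (@filterS2 _ 0^' _ _ _ _ _ H nin) => h; exact.
by split; [apply/cvg_ex; exists l|exact: cvg_lim fl].
Qed.

End SpacetimeDerivatives.

(** * Vector fields on spacetime and their commutator *)

Section VectorFields.
Set Implicit Arguments.
Unset Strict Implicit.
Context {R : realType}.
Implicit Types (T t : R) (x : 'rV[R]_3) (f : R -> 'rV[R]_3 -> R).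

Lemma is_axis_derive_coord T k
    (w : R -> 'rV[R]_3 -> 'rV[R]_3) i t x l :
  is_axis_derive T k w t x l ->
  is_axis_derive T k (fun s y => w s y 0 i) t x (l 0 i).
Proof.
move=> dw; rewrite /is_axis_derive /is_derive_within.
rewrite (_ : (fun h : R => _) = (fun M : 'rV[R]_3 => M 0 i) \o (fun h : R =>
    h^-1 *: (uncurried w (h *: axis k + (t, x)) - uncurried w (t, x)))).
  exact: (cvg_comp _ _ dw (@coord_continuous _ 1 3 0 i l)).
by apply/funext => h; rewrite /= !mxE.
Qed.

Lemma Omega_open : open (Omega : set 'rV[R]_3).
Proof.
have -> : (Omega : set 'rV[R]_3) = (fun x => x 0 ord_max) @^-1` [set y | 0 < y].
  by [].
by apply: open_comp; [move=> x _; exact: coord_continuous|exact: open_gt].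
Qed.

Lemma interior_spacetime_nbhs T t x : 0 < t < T -> Omega x ->
  \forall z \near (t, x), 0 < z.1 < T /\ Omega z.2.
Proof.
move=> tT xO; have tin : \forall s \near t, s \in `]0, T[.
  by apply: near_in_itvoo; rewrite in_itv.
have xin : \forall y \near x, Omega y.
  by apply: open_nbhs_nbhs; split=> //; exact: Omega_open.
exists ([set s | s \in `]0, T[], Omega) => //.
Qed.

Lemma continuous_on_interior T f t x : continuous_on T Omega f ->
  0 < t < T -> Omega x -> {for (t, x), continuous (uncurried f)}.
Proof.
move=> /subspace_continuousP fc tT xO.
have /andP[t0 tltT] := tT.
have := fc (t, x); rewrite within_interior; last first.
  apply: filterS (interior_spacetime_nbhs tT xO) => z [/andP[z0 zT] zO].
  by split=> //; rewrite /slab/= !ltW.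
by apply; split=> //; rewrite /slab/= !ltW.
Qed.

Lemma continuous_on_time T f t x : continuous_on T Omega f ->
  slab T t -> Omega x ->
  f s x @[s --> within [set s | 0 < s < T] t^'] --> f t x.
Proof.
move=> /subspace_continuousP fc tT xO A /(fc (t, x) (conj tT xO)).
rewrite /within/= => -[[U V] /= [tU xV] UV].
apply: nbhs_dnbhs; apply: filterS tU => s Us /andP[s0 sT].
apply: (UV (s, x)); first by split=> //; exact: nbhs_singleton xV.
by split=> //; rewrite /slab/= !ltW.
Qed.

(** At interior times all derivatives are two-sided and [mixed_derivatives_eq]
    applies.  Both second derivatives are continuous up to the end times, so
    that equality extends to them by taking limits along interior times. *)
Lemma axis_derive_comm T k l f t x : 0 < T -> class_C T 2 f ->
  slab T t -> Omega x ->
  axis_derive T k (axis_derive T l f) t x =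
  axis_derive T l (axis_derive T k f) t x.
Proof.
move=> T0 f2 tT xO.
have f1 m := class_C_axis_derive m f2.
have f0 m n := class_C_axis_derive m (f1 n).
have inside s : 0 < s < T ->
    axis_derive T k (axis_derive T l f) s x =
    axis_derive T l (axis_derive T k f) s x.
  move=> sT.
  have near_is_derive n m g : class_C T n.+1 g -> \forall y \near (s, x),
      is_derive y (axis m) (uncurried g) (uncurried (axis_derive T m g) y).
    move=> gn; apply: filterS (interior_spacetime_nbhs sT xO) => -[r y] [/= rT yO].
    apply: (is_axis_derive_interior rT).
    apply: (class_C_is_axis_derive gn) => //.
    by move: rT => /andP[r0 rT]; rewrite /slab/= !ltW.
  apply: (@mixed_derivatives_eq _ _ (uncurried f) (uncurried (axis_derive T l f))
    (uncurried (axis_derive T k f))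
    (uncurried (axis_derive T k (axis_derive T l f)))
    (uncurried (axis_derive T l (axis_derive T k f))) (s, x) (axis l) (axis k)).
  - exact: near_is_derive f2.
  - exact: near_is_derive f2.
  - exact: near_is_derive (f1 l).
  - exact: near_is_derive (f1 k).
  - exact: continuous_on_interior (class_C_continuous (f0 k l)) _ _.
  - exact: continuous_on_interior (class_C_continuous (f0 l k)) _ _.
have PF := interior_times_proper T0 tT.
have kl := continuous_on_time (class_C_continuous (f0 k l)) tT xO.
have lk := continuous_on_time (class_C_continuous (f0 l k)) tT xO.
rewrite -(cvg_lim _ kl)//; apply: cvg_lim => //.
apply: cvg_trans lk; apply: near_eq_cvg.
by apply: (@filterE _ t^') => s sT; rewrite (inside _ sT).
Qed.

Definition field_derive T (X : option 'I_3 -> R -> 'rV[R]_3 -> R) f t x : R :=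
  \sum_k X k t x * axis_derive T k f t x.

Lemma axis_derive_field_derive T k Y f t x : 0 < T -> class_C T 2 f ->
  slab T t -> Omega x ->
  (forall l, is_axis_derive T k (Y l) t x (axis_derive T k (Y l) t x)) ->
  axis_derive T k (field_derive T Y f) t x =
  \sum_l (axis_derive T k (Y l) t x * axis_derive T l f t x +
          Y l t x * axis_derive T k (axis_derive T l f) t x).
Proof.
move=> T0 f2 tT xO dY; apply: is_axis_deriveE => //.
apply: (is_derive_within_sum
  (F := fun l z => uncurried (Y l) z * uncurried (axis_derive T l f) z)) => l.
apply: is_derive_withinM; first exact: dY.
exact: (class_C_is_axis_derive (class_C_axis_derive _ f2)).
Qed.

(** Expanding by the product rule, the terms with second derivatives of [f]
    are [\sum_k \sum_l X_k Y_l d_k d_l f] in both products; they cancel by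
    [axis_derive_comm]. *)
Lemma field_commutator T X Y f t x : 0 < T -> class_C T 2 f ->
  slab T t -> Omega x ->
  (forall k l, is_axis_derive T k (X l) t x (axis_derive T k (X l) t x)) ->
  (forall k l, is_axis_derive T k (Y l) t x (axis_derive T k (Y l) t x)) ->
  field_derive T X (field_derive T Y f) t x -
    field_derive T Y (field_derive T X f) t x =
  \sum_l (field_derive T X (Y l) t x - field_derive T Y (X l) t x) *
    axis_derive T l f t x.
Proof.
move=> T0 f2 tT xO dX dY.
have expand Z Z' :
    (forall k l, is_axis_derive T k (Z' l) t x (axis_derive T k (Z' l) t x)) ->
    field_derive T Z (field_derive T Z' f) t x =
    \sum_l field_derive T Z (Z' l) t x * axis_derive T l f t x +
    \sum_k \sum_l Z k t x * Z' l t x * axis_derive T k (axis_derive T l f) t x.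
  move=> dZ'; rewrite /field_derive.
  under eq_bigr do rewrite axis_derive_field_derive// big_split/= mulrDr.
  rewrite big_split/=; congr (_ + _).
    under eq_bigr do rewrite mulr_sumr.
    rewrite exchange_big/=; apply: eq_bigr => l _.
    by rewrite mulr_suml; apply: eq_bigr => k _; rewrite mulrA.
  apply: eq_bigr => k _; rewrite mulr_sumr.
  by apply: eq_bigr => l _; rewrite mulrA.
rewrite !expand// [X in _ - (_ + X)]exchange_big/=.
rewrite [X in _ - (_ + X)](_ : _ = \sum_k \sum_l X k t x * Y l t x *
    axis_derive T k (axis_derive T l f) t x); last first.
  apply: eq_bigr => k _; apply: eq_bigr => l _.
  by rewrite axis_derive_comm// [Y l t x * _]mulrC.
rewrite opprD addrACA subrr addr0 -sumrB.
by apply: eq_bigr => l _; rewrite mulrBl.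
Qed.

End VectorFields.

(** * Frozen flux *)

Section FrozenFlux.
Set Implicit Arguments.
Unset Strict Implicit.
Context {R : realType}.
Implicit Types (T t : R) (x : 'rV[R]_3).

Lemma big_option {I : finType} (F : option I -> R) :
  \sum_k F k = F None + \sum_i F (Some i).
Proof.
rewrite (bigD1 None)//=; congr (_ + _).
rewrite (reindex_omap Some id) => [|[]//].
by apply: eq_bigl => i; rewrite eqxx.
Qed.

Definition advection_field (u : R -> 'rV[R]_3 -> 'rV[R]_3) (k : option 'I_3)
  (t : R) (x : 'rV[R]_3) : R := if k is Some i then u t x 0 i else 1.

Definition spatial_field (w : R -> 'rV[R]_3 -> 'rV[R]_3) (k : option 'I_3)
  (t : R) (x : 'rV[R]_3) : R := if k is Some i then w t x 0 i else 0.

Lemma material_field_derive T u (f : R -> 'rV[R]_3 -> R) :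
  material T u f = field_derive T (advection_field u) f.
Proof.
by apply/funext => t; apply/funext => x; rewrite /field_derive big_option mul1r.
Qed.

Lemma convective_field_derive T w (f : R -> 'rV[R]_3 -> R) t x :
  convective (w t x) (f t) x = field_derive T (spatial_field w) f t x.
Proof. by rewrite /field_derive big_option mul0r add0r. Qed.

(** The compressibility is defined through the derivative of [rho] in [p] at
    fixed entropy, whereas the chain rule along the flow produces the
    differential of [rho]; this identifies the two. *)
Lemma derive1_section (phi : R * R -> R) (p s : R) : differentiable phi (p, s) ->
  derive1 (fun p' => phi (p', s)) p = 'd phi (p, s) (1, 0).
Proof.
move=> dphi; rewrite derive1E -deriveE// /derive.
rewrite (_ : (fun h : R => _) = (fun h : R => h^-1 *: (phi (h *: (1, 0) + (p, s))
   - phi (p, s))))//.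
apply/funext => h /=; congr (_ *: (phi _ - _)).
by congr pair; rewrite /= scaler0 add0r.
Qed.

Context (eps T : R) (rho : R -> R -> R) (rho0 : R).
Context (q0 : 'rV[R]_3 -> R) (u0 B0 : 'rV[R]_3 -> 'rV[R]_3).
Context (S0 : 'rV[R]_3 -> R).
Context (q : R -> 'rV[R]_3 -> R) (u B : R -> 'rV[R]_3 -> 'rV[R]_3).
Context (S : R -> 'rV[R]_3 -> R).
Context (eps_gt0 : 0 < eps) (T_gt0 : 0 < T).
Context (rho_eos : equation_of_state rho rho0).
Context (sol : MHD_solution eps T rho q0 u0 B0 S0 q u B S).
Context (t : R) (x : 'rV[R]_3) (t_in : slab T t) (x_in : Omega x).

Let density := along eps rho q S.

Lemma density_neq0 : density t x != 0.
Proof.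
by rewrite gt_eqF// (lt_le_trans (eos_rho0_gt0 rho_eos))// (eos_lower_bound rho_eos).
Qed.

Lemma is_axis_derive_density k : is_axis_derive T k density t x
  ('d (fun z : R * R => rho z.1 z.2) (1 + eps * q t x, S t x)
    (eps * axis_derive T k q t x, axis_derive T k S t x)).
Proof.
have [cq _ _ cS] := mhd_C1 sol.
have dq := class_C_is_axis_derive (k := k) cq t_in x_in.
have dS := class_C_is_axis_derive (k := k) cS t_in x_in.
apply: (is_derive_within_comp
  (F := fun z => (1 + eps * uncurried q z, uncurried S z))
  (phi := fun z : R * R => rho z.1 z.2)); last first.
  exact: (eos_smooth rho_eos 1).1.
apply: is_derive_within_pair => //.
rewrite /is_derive_within (_ : (fun h : R => _) = (fun h : R => eps *
    (h^-1 *: (uncurried q (h *: axis k + (t, x)) - uncurried q (t, x))))).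
  by apply: cvgM => //; exact: cvg_cst.
by apply/funext => h; rewrite /GRing.scale/=; ring.
Qed.

Lemma axis_derive_density k : axis_derive T k density t x =
  'd (fun z : R * R => rho z.1 z.2) (1 + eps * q t x, S t x)
    (eps * axis_derive T k q t x, axis_derive T k S t x).
Proof. exact/is_axis_deriveE/is_axis_derive_density. Qed.

(** Conservation of mass.  By linearity of the differential, [D rho] is the
    differential of [rho] at [(eps D q, D S)]; the entropy equation removes the
    second component and the pressure equation evaluates the first. *)
Lemma material_density : material T u density t x =
  - (density t x * divergence (u t) x).
Proof.
rewrite material_field_derive /field_derive.
under eq_bigr do rewrite axis_derive_density -linearZ/=.
rewrite -linear_sum/=.
have -> : \sum_(k : option 'I_3) advection_field u k t x *:
    (eps * axis_derive T k q t x, axis_derive T k S t x) =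
    (eps * material T u q t x, material T u S t x).
  rewrite !material_field_derive /field_derive mulr_sumr.
  by elim/big_rec3: _ => // k a b c _ ->; rewrite mulrCA.
rewrite (mhd_entropy sol)//.
have -> : (eps * material T u q t x, 0) = (eps * material T u q t x) *: (1, 0) :> R * R.
  by congr pair; rewrite /GRing.scale/= ?mulr1 ?mulr0.
rewrite linearZ/= -derive1_section; last exact: (eos_smooth rho_eos 1).1.
have := mhd_pressure sol t_in x_in; have := density_neq0.
rewrite /density /along /compressibility.
set r := rho _ _; set rp := derive1 _ _; set Dq := material _ _ _ _ _.
set d := divergence _ _ => r0 /eqP; rewrite addr_eq0 => /eqP pressure.
have -> : (eps * Dq) *: rp = eps * r * (r^-1 * rp * Dq).
  by rewrite /GRing.scale/=; field.
by rewrite pressure; field; rewrite gt_eqF.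
Qed.

Let flux s y : 'rV[R]_3 := (density s y)^-1 *: B s y.

Lemma is_axis_derive_flux k i :
  is_axis_derive T k (fun s y => flux s y 0 i) t x
  (- (density t x) ^- 2 * axis_derive T k density t x * B t x 0 i +
   (density t x)^-1 * axis_derive T k B t x 0 i).
Proof.
have [_ _ cB _] := mhd_C1 sol.
rewrite (_ : (fun s y => _) = (fun s y => (density s y)^-1 * B s y 0 i)); last first.
  by apply/funext => s; apply/funext => y; rewrite /flux mxE.
apply: (is_derive_withinM (F := fun z => (uncurried density z)^-1)
  (G := fun z => uncurried B z 0 i)).
  have := is_derive_within_comp (is_axis_derive_density (k := k))
     (differentiable_Rinv density_neq0).
  rewrite axis_derive_density diff_Rinv ?density_neq0//.
exact: is_axis_derive_coord (class_C_is_axis_derive cB t_in x_in).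
Qed.

(** The induction equation gives [D B = B . grad u - (div u) B].  Eliminating
    [div u] by [material_density] makes it [rho D (rho^-1 B) = B . grad u]. *)
Lemma material_flux i : material T u (fun s y => flux s y 0 i) t x =
  convective (flux t x) (fun y => u t y 0 i) x.
Proof.
have [_ cu cB _] := mhd_C1 sol.
have uE k : axis_derive T k (fun s y => u s y 0 i) t x = axis_derive T k u t x 0 i.
  apply: is_axis_deriveE => //; apply: is_axis_derive_coord.
  exact: class_C_is_axis_derive cu _ _.
have -> : convective (flux t x) (fun y => u t y 0 i) x =
    (density t x)^-1 * convective (B t x) (u t) x 0 i.
  rewrite /convective summxE mulr_sumr; apply: eq_bigr => j _.
  have /= -> := uE (Some j).
  by rewrite /flux !mxE /GRing.scale/= mulrA.
have -> : convective (B t x) (u t) x 0 i =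
    material T u B t x 0 i + divergence (u t) x * B t x 0 i.
  by rewrite (mhd_induction sol)// !mxE subrK.
have -> : divergence (u t) x = - (density t x)^-1 * material T u density t x.
  by rewrite material_density mulrNN mulKf// density_neq0.
have -> : material T u B t x 0 i =
    \sum_k advection_field u k t x * axis_derive T k B t x 0 i.
  rewrite /material /convective big_option mul1r !mxE summxE.
  by congr (_ + _); apply: eq_bigr => j _; rewrite mxE.
rewrite !material_field_derive /field_derive mulr_sumr mulr_suml -big_split mulr_sumr.
apply: eq_bigr => k _.
rewrite (is_axis_deriveE T_gt0 t_in (is_axis_derive_flux (i := i))) /=.
by field; exact: density_neq0.
Qed.

End FrozenFlux.

Theorem proposition3p2 (R : realType) (eps T : R) (rho : R -> R -> R) (rho0 : R)
    (q0 : 'rV[R]_3 -> R) (u0 B0 : 'rV[R]_3 -> 'rV[R]_3) (S0 : 'rV[R]_3 -> R)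
    (q : R -> 'rV[R]_3 -> R) (u B : R -> 'rV[R]_3 -> 'rV[R]_3)
    (S : R -> 'rV[R]_3 -> R)
    (eps_gt0 : 0 < eps) (T_gt0 : 0 < T)
    (rho_eos : equation_of_state rho rho0)
    (sol : MHD_solution eps T rho q0 u0 B0 S0 q u B S)
    (f : R -> 'rV[R]_3 -> R) (f_C2 : class_C T 2 f)
    (t : R) (x : 'rV[R]_3) (t_in : slab T t) (x_in : Omega x) :
  magnetic_derivative eps rho q S B (material T u f) t x
  = material T u (magnetic_derivative eps rho q S B f) t x.
Proof.
pose flux s y : 'rV[R]_3 := (along eps rho q S s y)^-1 *: B s y.
have magneticE g : magnetic_derivative eps rho q S B g =
    field_derive T (spatial_field flux) g.
  by apply/funext => s; apply/funext => y; exact: (convective_field_derive T flux).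
rewrite !magneticE !material_field_derive; apply/eqP; rewrite -subr_eq0.
have const_derive k c : is_axis_derive T k (fun _ _ => c) t x (0 : R).
  exact: is_derive_within_cst.
have flux_derive := is_axis_derive_flux T_gt0 rho_eos sol t_in x_in.
have [_ cu _ _] := mhd_C1 sol.
rewrite field_commutator//; first last.
- move=> k [i|]; apply: is_axis_derive_val => //; last exact: const_derive.
  apply: is_axis_derive_coord.
  exact: class_C_is_axis_derive cu t_in x_in.
- move=> k [i|]; apply: is_axis_derive_val => //; last exact: const_derive.
  exact: flux_derive.
(* Space components cancel by frozen flux; time components are constant. *)
apply/eqP/big1 => -[i|] _.
  rewrite -material_field_derive -convective_field_derive.
  have -> := material_flux eps_gt0 T_gt0 rho_eos sol t_in x_in i.
  by rewrite subrr mul0r.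
by rewrite /field_derive !big1 ?subr0 ?mul0r// => k _;
  rewrite (is_axis_deriveE T_gt0 t_in (const_derive k _)) mulr0.
Qed.
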